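(* Let $H$ be a complex Hilbert space and let $\{\Lambda_k\}_{k\in\mathbb{Z}}$ be a sequence in $\mathcal{L}(H)$. Then $\{\Lambda_k\}_{k\in\mathbb{Z}}$ is not phase retrieval if and only if there exist nonzero elements $x,y\in H$ such that $x\notin i\mathbb{R}y$ and $\operatorname{Re}\langle \Lambda_k(x),\Lambda_k(y)\rangle=0$ for all $k\in\mathbb{Z}$.
   Context: $\mathcal{L}(H)$ denotes the space of all bounded linear operators on $H$. A sequence $\{\Lambda_k\}_{k\in\mathbb{Z}}$ in $\mathcal{L}(H)$ is called phase retrieval (or phase retrievable) if for every $x,y\in H$ satisfying $\|\Lambda_k(x)\|=\|\Lambda_k(y)\|$ for all $k\in\mathbb{Z}$, there exists $\alpha\in\mathbb{C}$ with $|\alpha|=1$ and $x=\alpha y$. For $y\in H$, $i\mathbb{R}y=\{iay: a\in\mathbb{R}\}$. *)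

(* Defs.v *)
From HB Require Import structures.
From mathcomp Require Import all_boot all_order all_algebra.
From mathcomp Require Import sesquilinear complex.
From mathcomp Require Import boolp classical_sets reals topology normedtype.
Set Implicit Arguments.
Unset Strict Implicit.
Unset Printing Implicit Defensive.
Import Order.TTheory GRing.Theory Num.Theory.
Import numFieldNormedType.Exports.
Local Open Scope classical_set_scope.
Local Open Scope ring_scope.
Local Open Scope complex_scope.

(* [inner] is linear in its first argument and conjugate-linear in its second.
   As in the library, the norm takes its values in R[i]. *)
HB.mixin Record CompleteNormedModule_isHilbert (R : realType) (H : Type)
    of CompleteNormedModule R[i] H := {
  inner : {dot H for (@Num.conj R[i])} ;
  inner_norm : forall x : H, inner x x = `|x| ^+ 2
}.

#[short(type="hilbertType")]
HB.structure Definition Hilbert (R : realType) :=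
  {H of CompleteNormedModule R[i] H & CompleteNormedModule_isHilbert R H}.

Record bounded_operator (R : realType) (H : hilbertType R) := BoundedOperator {
  operator_fun :> {linear H -> H} ;
  operator_bounded : bounded_near operator_fun (nbhs (0 : H))
}.

Lemma bounded_operatorP (R : realType) (H : hilbertType R)
    (f : {linear H -> H}) :
  bounded_near f (nbhs (0 : H)) <->
  exists M : R, forall x : H, `|f x| <= M%:C * `|x|.
Proof.
split=> [/linear_boundedP /pinfty_ex_gt0 [M M0 fM]|[M fM]].
  exists (complex.Re M) => x.
  by rewrite RRe_real ?gtr0_real.
apply/linear_boundedP; exists M%:C; split; first by rewrite complex_real.
by move=> r /ltW Mr x; apply: le_trans (fM x) _; rewrite ler_wpM2r.
Qed.

Definition phase_retrieval (R : realType) (H : hilbertType R)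
    (L : int -> bounded_operator H) : Prop :=
  forall x y : H, (forall k : int, `|L k x| = `|L k y|) ->
  exists a : R[i], `|a| = 1 /\ x = a *: y.

Definition imaginary_line (R : realType) (H : hilbertType R) (y : H) : set H :=
  [set (0 +i* a) *: y | a in [set: R]].

(* Main.v *)
Require Import Defs.
From mathcomp Require Import all_boot all_order all_algebra.
From mathcomp Require Import complex.
From mathcomp Require Import classical_sets reals.
From mathcomp Require Import sesquilinear boolp ring.
Import Order.TTheory GRing.Theory Num.Theory.
Local Open Scope ring_scope.

(** The linear bijection sending a pair (x, y) to (x + y, x - y) turns one
    side of the equivalence into the other.  Writing u = x + y and v = x - y,
    polarization gives |L u| = |L v| exactly when Re <L x, L y> = 0, for every
    linear L ([inner_Re0P]): the norm hypotheses of phase retrieval on (u, v)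
    are the orthogonality hypotheses on (x, y).  For y nonzero,
    u is a unimodular multiple of v exactly when x is a purely imaginary
    multiple of y, because the Cayley map z |-> (z + 1) / (z - 1) exchanges the
    unit circle (without 1) and the imaginary axis ([cayley_collinearP]).
    So a counterexample (u, v) to phase retrieval is the same thing as a pair
    (x, y) of the required kind; x and y are then nonzero because x = 0 means
    u = -v, while y = 0 means u = v. *)

(** Subtracting the two expansions of the square norm leaves
    |u + v|^2 - |u - v|^2 = 4 Re <u, v>. *)
Lemma inner_Re0P (R : realType) (H : hilbertType R) (u v : H) :
  complex.Re (inner u v) = 0 <-> `|u + v| = `|u - v|.
Proof.
have polar : `|u + v| ^+ 2 - `|u - v| ^+ 2 = 4 * (complex.Re (inner u v))%:C%C.
  rewrite -!inner_norm dnormD dnormB complexRe ReE.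
  by field.
split=> [re0 | norm_eq].
  move: polar; rewrite re0 mulr0 => /eqP.
  by rewrite subr_eq0 eqrXn2 ?normr_ge0 // => /eqP.
move/esym/eqP: polar; rewrite norm_eq subrr mulf_eq0 pnatr_eq0 /= => /eqP.
by case.
Qed.

(** The condition [c^* = - c] says that c lies on the imaginary axis.  In both
    directions the new scalar is the image of the old one under the involution
    z |-> (z + 1) / (z - 1). *)
Lemma cayley_collinearP (C : numClosedFieldType) (V : lmodType C) (x y : V) :
  y != 0 ->
  (exists a : C, `|a| = 1 /\ x + y = a *: (x - y)) <->
  (exists c : C, c^* = - c /\ x = c *: y).
Proof.
move=> y_neq0; split=> [[a [a_unit xy]] | [c [c_imag ->]]].
  have a_neq0 : a != 0 by rewrite -normr_eq0 a_unit oner_eq0.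
  have a1_neq0 : a - 1 != 0.
    apply: contra y_neq0; rewrite subr_eq0 => /eqP a1.
    move/eqP: xy.
    rewrite a1 scale1r [x + y]addrC [x - y]addrC (inj_eq (addIr x)).
    by rewrite -subr_eq0 opprK -mulr2n -scaler_nat scaler_eq0 pnatr_eq0.
  exists ((a + 1) / (a - 1)); split.
    (* On the unit circle, conjugation is inversion. *)
    have aJ : a^* = a^-1 by rewrite invC_norm a_unit expr1n invr1 mul1r.
    rewrite fmorph_div rmorphD rmorphB rmorph1 /= aJ.
    by field; rewrite a1_neq0 a_neq0 mulN1r -oppr_eq0 opprB.
  apply: (can_inj (scalerK a1_neq0)); rewrite /= scalerA mulrCA divff // mulr1.
  rewrite scalerBl scalerDl !scale1r; apply/eqP.
  by rewrite subr_eq -addrA [y + x]addrC xy -scalerDr addrC subrK.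
have c1_neq0 : c - 1 != 0.
  rewrite subr_eq0; apply/eqP => c1; move/eqP: c_imag.
  by rewrite c1 rmorph1 -subr_eq0 opprK (pnatr_eq0 _ 2).
exists ((c + 1) / (c - 1)); split.
  (* Conjugation maps [c + 1] to [- (c - 1)]. *)
  rewrite normf_div -[`|c + 1|]norm_conjC rmorphD rmorph1 /= c_imag.
  by rewrite addrC distrC divff // normr_eq0.
have -> : c *: y - y = (c - 1) *: y by rewrite scalerBl scale1r.
by rewrite scalerA divfK // scalerDl scale1r.
Qed.

Lemma imaginary_lineP (R : realType) (H : hilbertType R) (x y : H) :
  imaginary_line y x <-> exists c : R[i], Num.conj c = - c /\ x = c *: y.
Proof.
split=> [[t _ <-] | [[s t] [c_imag ->]]].
  exists (Complex 0 t); split=> //; apply/eqP.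
  by rewrite eq_complex /= oppr0 !eqxx.
case: c_imag => /eqP; rewrite -subr_eq0 opprK -mulr2n mulrn_eq0 /= => /eqP ->.
by exists t.
Qed.

Theorem theorem2p1 (R : realType) (H : hilbertType R)
    (L : int -> bounded_operator H) :
  ~ phase_retrieval L <->
  exists x y : H,
    [/\ x <> 0, y <> 0, ~ imaginary_line y x
      & forall k : int, complex.Re (inner (L k x) (L k y)) = 0].
Proof.
split=> [/existsNP [u /existsNP [v /not_implyP [norm_eq not_coll]]] |].
  pose x := 2^-1 *: (u + v); pose y := 2^-1 *: (u - v).
  have half (w : H) : 2^-1 *: (w + w) = w.
    by rewrite -mulr2n -[w *+ 2]scaler_nat scalerA mulVf ?scale1r // pnatr_eq0.
  have xDy : x + y = u by rewrite /x /y -scalerDr addrACA subrr addr0 half.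
  have xBy : x - y = v.
    by rewrite /x /y -scalerBr opprB [v - u]addrC addrACA subrr add0r half.
  have x_neq0 : x <> 0.
    move=> x0; apply: not_coll; exists (- 1); rewrite normrN1; split=> //.
    by rewrite -xDy -xBy x0 scaleN1r sub0r opprK add0r.
  have y_neq0 : y <> 0.
    move=> y0; apply: not_coll; exists 1; rewrite normr1; split=> //.
    by rewrite -xDy -xBy y0 scale1r subr0 addr0.
  exists x, y; split=> // [/imaginary_lineP | k].
    move/(cayley_collinearP _ _ _ _ (introN eqP y_neq0)).
    by rewrite xDy xBy.
  by apply/inner_Re0P; rewrite -linearD -linearB xDy xBy.
move=> [x [y [_ /eqP y_neq0 x_notin re0]]] phase; apply: x_notin.
apply/imaginary_lineP/cayley_collinearP => //; apply: phase => k.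
by rewrite linearD linearB; apply/inner_Re0P.
Qed.
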